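(* Let $\mathbf P=(P,\leq,{}',0,1)$ be a bounded poset with an antitone involution ${}'$. Then its Dedekind–MacNeille completion $\mathbf{DM}(\mathbf P)$ is paraorthomodular if and only if for all $X,Y\subseteq P$: $L(X)\subsetneqq L(Y)$ implies $L(Y)\cap LU(X')\neq\{0\}$.
   Context: A bounded poset with an antitone involution is $(P,\leq,{}',0,1)$ where $(P,\leq)$ is a poset with least element $0$ and greatest element $1$, $x''=x$ for all $x$, and $x\leq y$ implies $y'\leq x'$. For $A\subseteq P$: $L(A)$ is the set of lower bounds of $A$ in $P$, $U(A)$ the set of upper bounds, $LU(A)=L(U(A))$, $A'=\{x'\mid x\in A\}$. $\mathbf{DM}(\mathbf P)=(\{L(A)\mid A\subseteq P\},\subseteq)$ is a complete lattice, equipped with the antitone involution $X^\bot:=L(X')$, with least element $\{0\}$ and greatest element $P$. A bounded lattice with an antitone involution ${}'$ is paraorthomodular if $x\leq y$ and $x'\wedge y=0$ imply $x=y$. *)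

(* Defs.v *)
From HB Require Import structures.
From mathcomp Require Import all_boot all_order.
From mathcomp Require Import mathcomp_extra boolp classical_sets.

Set Implicit Arguments.
Unset Strict Implicit.
Unset Printing Implicit Defensive.

Import Order.TTheory.

Local Open Scope order_scope.
Local Open Scope classical_set_scope.

HB.mixin Record hasAntitoneInvolution (d : Order.disp_t) T
    of Order.TBPOrder d T := {
  invol : T -> T;
  involK : forall x : T, invol (invol x) = x;
  le_invol : forall x y : T, x <= y -> invol y <= invol x
}.

#[short(type="involTBPOrderType")]
HB.structure Definition InvolTBPOrder d :=
  { T of Order.TBPOrder d T & hasAntitoneInvolution d T }.

#[short(type="involTBLatticeType")]
HB.structure Definition InvolTBLattice d :=
  { T of Order.TBLattice d T & hasAntitoneInvolution d T }.

Definition paraorthomodular d (T : involTBLatticeType d) : Prop :=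
  forall x y : T, x <= y -> Order.meet (invol x) y = \bot -> x = y.

(* The operators L and U are [lbound] and [ubound]. *)
Section BoundTheory.
Context {d : Order.disp_t} {P : porderType d}.
Implicit Types A B : set P.

Lemma lboundS A B : A `<=` B -> lbound B `<=` lbound A.
Proof. by move=> AB x Bx y /AB; apply: Bx. Qed.

Lemma uboundS A B : A `<=` B -> ubound B `<=` ubound A.
Proof. by move=> AB x Bx y /AB; apply: Bx. Qed.

Lemma lbubS A : A `<=` lbound (ubound A).
Proof. by move=> x Ax y; apply. Qed.

Lemma lbublb A : lbound (ubound (lbound A)) = lbound A.
Proof.
apply/seteqP; split; last exact: lbubS.
by apply: lboundS => x Ax y; apply.
Qed.

Lemma lboundU A B : lbound (A `|` B) = lbound A `&` lbound B.
Proof.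
apply/seteqP; split=> [x ABx | x [Ax Bx] y [/Ax|/Bx]//].
by split=> y ?; apply: ABx; [left|right].
Qed.
End BoundTheory.

Section DM.
Context {d : Order.disp_t} (P : involTBPOrderType d).
Implicit Types A B : set P.

(* [asbool] is only there because the predicate of a subType is boolean. *)
Record DM := MkDM {
  dm_set :> set P;
  _ : `[< exists A, dm_set = lbound A >]
}.

HB.instance Definition _ := [isSub for dm_set].
HB.instance Definition _ := [Choice of DM by <:].

Definition dm_lbound A : DM :=
  @MkDM (lbound A) (asboolT (ex_intro _ A erefl)).

Lemma dm_setP (X : DM) : exists A, dm_set X = lbound A.
Proof. by case: X => X /= /asboolP. Qed.

Lemma dm_lbubE (X : DM) : lbound (ubound X) = X.
Proof. by have [A ->] := dm_setP X; exact: lbublb. Qed.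

Lemma dm_inj (X Y : DM) : dm_set X = dm_set Y -> X = Y.
Proof. exact: val_inj. Qed.

Definition dm_le (X Y : DM) : bool := `[< dm_set X `<=` dm_set Y >].

Fact dm_le_refl : reflexive dm_le.
Proof. by move=> X; apply/asboolP. Qed.

Fact dm_le_anti : antisymmetric dm_le.
Proof.
move=> X Y /andP[/asboolP XY /asboolP YX].
by apply: dm_inj; apply/seteqP.
Qed.

Fact dm_le_trans : transitive dm_le.
Proof.
move=> Y X Z /asboolP XY /asboolP YZ; apply/asboolP.
exact: subset_trans XY YZ.
Qed.

Fact dm_display : Order.disp_t. Proof. exact: d. Qed.

HB.instance Definition _ := Order.Le_isPOrder.Build dm_display DM
  dm_le_refl dm_le_anti dm_le_trans.

Lemma dm_leE (X Y : DM) : (X <= Y) = `[< dm_set X `<=` dm_set Y >].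
Proof. by []. Qed.

Definition dm_meet (X Y : DM) : DM := dm_lbound (ubound X `|` ubound Y).
Definition dm_join (X Y : DM) : DM := dm_lbound (ubound (X `|` Y)).

Lemma dm_set_meet (X Y : DM) : dm_set (dm_meet X Y) = dm_set X `&` dm_set Y.
Proof. by rewrite /= lboundU !dm_lbubE. Qed.

Fact dm_lexI (X Y Z : DM) : (X <= dm_meet Y Z) = (X <= Y) && (X <= Z).
Proof.
rewrite !dm_leE dm_set_meet.
apply/asboolP/andP => [XYZ|[/asboolP XY /asboolP XZ]].
  by split; apply/asboolP => x /XYZ[].
by move=> x Xx; split; [exact: XY|exact: XZ].
Qed.

Fact dm_leUx (X Y Z : DM) : (dm_join X Y <= Z) = (X <= Z) && (Y <= Z).
Proof.
rewrite !dm_leE.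
apply/asboolP/andP => [XYZ|[/asboolP XZ /asboolP YZ]].
  by split; apply/asboolP => x Xx; apply/XYZ/lbubS; [left|right].
rewrite /= -(dm_lbubE Z); apply/lboundS/uboundS => x [/XZ|/YZ] //.
Qed.

HB.instance Definition _ := Order.POrder_MeetJoin_isLattice.Build dm_display DM
  dm_lexI dm_leUx.

Fact dm_le0x (X : DM) : dm_lbound [set: P] <= X.
Proof.
rewrite dm_leE; apply/asboolP => x Lx; have [A ->] := dm_setP X.
by move=> y _; apply: Lx.
Qed.

Fact dm_lex1 (X : DM) : X <= dm_lbound set0.
Proof. by rewrite dm_leE; apply/asboolP => x _ y. Qed.

HB.instance Definition _ := Order.hasBottom.Build dm_display DM dm_le0x.
HB.instance Definition _ := Order.hasTop.Build dm_display DM dm_lex1.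

Lemma dm_set_bot : dm_set (\bot : DM) = [set \bot].
Proof.
apply/seteqP; split=> [x Lx|x -> y _] /=; last exact: le0x.
by apply/le_anti; rewrite le0x andbT; apply: Lx.
Qed.

Lemma dm_set_top : dm_set (\top : DM) = [set: P].
Proof. by apply/seteqP; split=> x _. Qed.

Definition dm_invol (X : DM) : DM := dm_lbound (@invol d P @` X).

Fact dm_involK (X : DM) : dm_invol (dm_invol X) = X.
Proof.
apply: dm_inj; rewrite -[RHS]dm_lbubE /=.
apply/seteqP; split=> x Hx y Hy.
  rewrite -(involK y); apply: Hx; exists (invol y) => // _ [z Xz <-].
  by apply: le_invol; apply: Hy.
case: Hy => z Lz <-; apply: Hx => t Xt.
by rewrite -(involK t); apply/le_invol/Lz; exists t.
Qed.

Fact dm_le_invol (X Y : DM) : X <= Y -> dm_invol Y <= dm_invol X.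
Proof.
rewrite !dm_leE => /asboolP XY; apply/asboolP.
exact/lboundS/image_subset.
Qed.

HB.instance Definition _ :=
  hasAntitoneInvolution.Build dm_display DM dm_involK dm_le_invol.

Lemma dm_complete (S : set DM) :
  (exists X : DM, lbound S X /\ forall Y, lbound S Y -> Y <= X) /\
  (exists X : DM, ubound S X /\ forall Y, ubound S Y -> X <= Y).
Proof.
split.
  exists (dm_lbound (\bigcup_(X in S) ubound (dm_set X))); split=> [Y SY|Y LY].
    rewrite dm_leE; apply/asboolP => x Lx; rewrite -dm_lbubE => y Uy.
    by apply: Lx; exists Y.
  rewrite dm_leE; apply/asboolP => x Yx y [Z SZ]; apply.
  by move: (LY _ SZ); rewrite dm_leE => /asboolP; apply.
exists (dm_lbound (ubound (\bigcup_(X in S) dm_set X))); split=> [Y SY|Y UY].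
  by rewrite dm_leE; apply/asboolP => x Yx; apply: lbubS; exists Y.
rewrite dm_leE -[dm_set Y]dm_lbubE; apply/asboolP/lboundS/uboundS => x [Z SZ Zx].
by move: (UY _ SZ); rewrite dm_leE => /asboolP; apply.
Qed.
End DM.

(* Main.v *)
Require Import Defs.
From HB Require Import structures.
From mathcomp Require Import all_boot all_order.
From mathcomp Require Import mathcomp_extra boolp classical_sets.

(** Every element of [DM P] has the form [lbound X], so paraorthomodularity is
    a statement about pairs [lbound X], [lbound Y]. An antitone involution
    carries lower bounds to upper bounds and loses none, by bijectivity;
    therefore the involute of [lbound X] in [DM P], which is by definition
    [lbound (invol @` lbound X)], equals [lbound (ubound (invol @` X))]
    ([dm_set_invol_lbound]). As the meet of [DM P] is intersection and its
    bottom is [[set \bot]], the set in the theorem is the meet occurring in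
    paraorthomodularity ([dm_set_invol_meet]). The two conditions are then
    contrapositives: an inclusion with zero meet is an equality, and a proper
    inclusion has nonzero meet. *)

Local Open Scope order_scope.
Local Open Scope classical_set_scope.

Lemma image_invol_lbound (d : Order.disp_t) (P : involTBPOrderType d)
    (A : set P) :
  invol @` lbound A = ubound (invol @` A).
Proof.
apply/seteqP; split=> [_ [x Ax <-] _ [a Aa <-]|y Uy].
  exact/le_invol/Ax.
exists (invol y); last exact: involK.
by move=> a Aa; rewrite -(involK a); apply/le_invol/Uy; exists a.
Qed.

(** This is what lets the involution of [DM P] be computed from any set [A]
    generating the element, without reference to the whole of [lbound A]. *)
Lemma dm_set_invol_lbound (d : Order.disp_t) (P : involTBPOrderType d)
    (A : set P) :
  dm_set (invol (dm_lbound A)) = lbound (ubound (invol @` A)).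
Proof. by rewrite -image_invol_lbound. Qed.

Lemma dm_set_invol_meet (d : Order.disp_t) (P : involTBPOrderType d)
    (X Y : set P) :
  dm_set (Order.meet (invol (dm_lbound X)) (dm_lbound Y)) =
  lbound Y `&` lbound (ubound (invol @` X)).
Proof.
rewrite [LHS]dm_set_meet dm_set_invol_lbound.
exact: setIC.
Qed.

Theorem theorem4p8 (d : Order.disp_t) (P : involTBPOrderType d) :
  paraorthomodular (DM P) <->
  (forall X Y : set P,
     lbound X `<` lbound Y ->
     lbound Y `&` lbound (ubound (invol @` X)) <> [set \bot]).
Proof.
split=> [pom X Y [XY nYX] meet0 | proper_meet x y].
  have eqXY : dm_lbound X = dm_lbound Y.
    apply: pom; first by rewrite dm_leE; apply/asboolP.
    by apply: dm_inj; rewrite dm_set_invol_meet meet0 dm_set_bot.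
  by apply: nYX; rewrite -[lbound Y]/(dm_set (dm_lbound Y)) -eqXY.
have [X defX] := dm_setP x; have [Y defY] := dm_setP y.
have -> : x = dm_lbound X by exact: dm_inj.
have -> : y = dm_lbound Y by exact: dm_inj.
rewrite dm_leE => /asboolP XY meet0.
apply: dm_inj; apply/seteqP; split=> //; apply: contrapT => nYX.
apply: (proper_meet X Y) => //.
by rewrite -dm_set_invol_meet meet0 dm_set_bot.
Qed.
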